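(* (Soft-policy SOC majorizes SOC.) Let $\lambda^P>0$. For a policy sequence $\underline{\pi}$ let $J_{\mathrm{SOC}}(\underline{\pi})=\mathbb{E}_{p_{(\underline{\pi},\underline{\iota})}}[\underline{c}_T]$, and for a policy sequence $\underline{\pi}^k$ let $$J_{\mathrm{SP\text{-}SOC}}(\underline{\pi}\mid\underline{\pi}^k)=\mathbb{E}_{p_{(\underline{\pi},\underline{\iota})}}\Bigl[\underline{c}_T+\tfrac1{\lambda^P}\sum_{t=0}^{T-1}\log\tfrac{\pi_t}{\pi_t^k}\Bigr].$$ Then $J_{\mathrm{SP\text{-}SOC}}(\cdot\mid\underline{\pi}^k)$ majorizes $J_{\mathrm{SOC}}$ at $\underline{\pi}^k$, i.e. $$J_{\mathrm{SP\text{-}SOC}}(\underline{\pi}^k\mid\underline{\pi}^k)=J_{\mathrm{SOC}}(\underline{\pi}^k),\qquad J_{\mathrm{SP\text{-}SOC}}(\underline{\pi}\mid\underline{\pi}^k)\ge J_{\mathrm{SOC}}(\underline{\pi})\quad\text{for all }\underline{\pi}.$$ Consequently the iteration $\underline{\pi}^{k+1}\in\arg\min_{\underline{\pi}}J_{\mathrm{SP\text{-}SOC}}(\underline{\pi}\mid\underline{\pi}^k)$ guarantees descent: $J_{\mathrm{SOC}}(\underline{\pi}^{k+1})\le J_{\mathrm{SOC}}(\underline{\pi}^k)$.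
   Context: Setting: a discrete-time controlled stochastic system with finite horizon $T$, states $x_t$, actions $u_t$, and trajectories $\underline{\xi}_T=(x_0,u_0,\dots,x_{T-1},u_{T-1},x_T)$. A policy sequence $\underline{\pi}=(\pi_0,\dots,\pi_{T-1})$ consists of conditional distributions $\pi_t(u_t\mid x_t)$; the system's fixed true transition kernels are $\underline{\iota}=(\iota_0,\dots,\iota_{T-1})$, with $\iota_t(x_{t+1}\mid x_t,u_t)$. The induced trajectory distribution is $p_{(\underline{\pi},\underline{\iota})}(\underline{\xi}_T)=p(x_0)\prod_{t=0}^{T-1}\pi_t(u_t\mid x_t)\,\iota_t(x_{t+1}\mid x_t,u_t)$, with a fixed initial state distribution $p(x_0)$. Costs: $\underline{c}_T(\underline{\xi}_T)=\sum_{t=0}^{T-1}c_t(x_t,u_t)+c_T(x_T)$ with $c_t\ge0$ and $c_T\ge0$. Standing assumption: all trajectory expectations that appear are finite for the policies considered. In $J_{\mathrm{SP\text{-}SOC}}$ the log-ratio $\log\frac{\pi_t}{\pi_t^k}$ is evaluated along the trajectory at $(x_t,u_t)$, and policies are absolutely continuous with respect to the baseline $\underline{\pi}^k$. *)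

(* Defs.v *)
From HB Require Import structures.
From mathcomp Require Import all_boot all_order all_algebra.
From mathcomp Require Import all_classical all_reals all_analysis.
From mathcomp Require Import measurable_realfun.

Set Implicit Arguments.
Unset Strict Implicit.
Unset Printing Implicit Defensive.
Import Order.TTheory GRing.Theory Num.Theory.

Local Open Scope classical_set_scope.
Local Open Scope ring_scope.
Local Open Scope ereal_scope.

(* ((x_0, ..., x_n), (u_0, ..., u_{n-1})) *)
Notation traj X U n := (n.+1.-tuple X * n.-tuple U)%type.

Section trajectories.
Context d d' (X : measurableType d) (U : measurableType d').

(* (x_t, u_t) for t < n *)
Definition stage_at n (xi : traj X U n) (t : 'I_n) : X * U :=
  (tnth xi.1 (widen_ord (leqnSn n) t), tnth xi.2 t).

Definition final_state n (xi : traj X U n) : X := tnth xi.1 ord_max.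

Definition traj_init (x : X) : traj X U 0 := ([tuple x], [tuple]).

Definition traj_extend n (xi : traj X U n) (ux : U * X) : traj X U n.+1 :=
  ([tuple of rcons xi.1 ux.2], [tuple of rcons xi.2 ux.1]).

Lemma measurable_traj_init : measurable_fun [set: X] traj_init.
Proof.
apply/measurable_fun_pairP; split; apply/measurable_fun_tnthP => /= i.
  by rewrite (_ : _ \o _ = id)//; apply: funext => x /=; rewrite ord1.
by case: i.
Qed.

HB.instance Definition _ :=
  isMeasurableFun.Build _ _ _ _ traj_init measurable_traj_init.

Lemma measurable_final_state n :
  measurable_fun [set: traj X U n] (@final_state n).
Proof.
apply: (@measurableT_comp _ _ _ _ _ _ (fun y : n.+1.-tuple X => tnth y ord_max)).
  exact: measurable_tnth.
exact: measurable_fst.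
Qed.

Lemma measurable_traj_extend n :
  measurable_fun [set: traj X U n * (U * X)]
    (fun z => traj_extend z.1 z.2).
Proof.
have rconsE dT (T : measurableType dT) dS (S : measurableType dS) m
    (f : S -> m.-tuple T) (g : S -> T) :
    measurable_fun [set: S] f -> measurable_fun [set: S] g ->
    measurable_fun [set: S] (fun s => [tuple of rcons (f s) (g s)]).
  move=> mf mg; apply/measurable_fun_tnthP => /= i.
  have [im|im] := ltnP i m.
    rewrite (_ : _ \o _ = (fun y : m.-tuple T => tnth y (Ordinal im)) \o f).
      by apply: measurableT_comp => //; exact: measurable_tnth.
    apply: funext => s /=; rewrite (tnth_nth (g s)) /= nth_rcons size_tuple im.
    by rewrite (tnth_nth (g s)).
  rewrite (_ : _ \o _ = g)//; apply: funext => s /=.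
  rewrite (tnth_nth (g s)) /= nth_rcons size_tuple ltnNge im /=.
  by case: ifP => //; rewrite eqn_leq im -ltnS ltn_ord.
apply/measurable_fun_pairP; split.
  apply: (rconsE _ _ _ _ n.+1
    (fun z : traj X U n * (U * X) => z.1.1) (fun z => z.2.2)).
    exact: (measurableT_comp measurable_fst measurable_fst).
  exact: (measurableT_comp measurable_snd measurable_snd).
apply: (rconsE _ _ _ _ n
    (fun z : traj X U n * (U * X) => z.1.2) (fun z => z.2.1)).
  exact: (measurableT_comp measurable_snd measurable_fst).
exact: (measurableT_comp measurable_fst measurable_snd).
Qed.

End trajectories.

Section trajectory_law.
Context d d' (X : measurableType d) (U : measurableType d') (R : realType).

Section step.
Variables (p : R.-pker X ~> U) (iota : R.-pker (X * U) ~> X).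

(* The law of (u_n, x_{n+1}) given xi = (x_0, u_0, ..., x_n): u_n ~ p(.|x_n) and
   x_{n+1} ~ iota(.|x_n, u_n). *)
Definition next_law n (xi : traj X U n) : {measure set (U * X) -> \bar R} :=
  mkproduct p iota (final_state xi).

Let measurable_next_law n (A : set (U * X)) : measurable A ->
  measurable_fun [set: traj X U n] (fun xi => next_law xi A : \bar R).
Proof.
move=> mA; apply: (measurableT_comp (measurable_kproduct p iota mA)).
exact: measurable_final_state.
Qed.

HB.instance Definition _ n := isKernel.Build _ _ _ _ _
  (@next_law n) (@measurable_next_law n).

Let next_lawT n (xi : traj X U n) : next_law xi [set: U * X] = 1.
Proof.
transitivity (\int[p (final_state xi)]_u iota (final_state xi, u) [set: X]).
  apply: eq_integral => u _.
  transitivity (\int[iota (final_state xi, u)]_x cst 1 x).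
    by apply: eq_integral => x _; rewrite indicT.
  by rewrite integral_cst// mul1e.
under eq_integral do rewrite prob_kernel.
by rewrite integral_cst// mul1e prob_kernel.
Qed.

HB.instance Definition _ n := Kernel_isProbability.Build _ _ _ _ _
  (@next_law n) (@next_lawT n).

Section extend.
Variables (n : nat) (P : probability (traj X U n) R).

Definition traj_step (A : set (traj X U n.+1)) : \bar R :=
  \int[P]_xi next_law xi (traj_extend xi @^-1` A).

Let measurable_preimage A : measurable A ->
  measurable [set z : traj X U n * (U * X) | A (traj_extend z.1 z.2)].
Proof.
move=> mA; rewrite -[X in measurable X]setTI.
exact: (measurable_traj_extend (n := n)).
Qed.

Let measurable_section A (xi : traj X U n) : measurable A ->
  measurable (traj_extend xi @^-1` A : set (U * X)).
Proof.
move=> mA; have := measurable_xsection xi (measurable_preimage mA).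
by rewrite xsectionE.
Qed.

Let measurable_integrand A : measurable A ->
  measurable_fun [set: traj X U n]
    (fun xi => next_law xi (traj_extend xi @^-1` A)).
Proof.
move=> mA; have mB := measurable_preimage mA.
pose B := [set z : traj X U n * (U * X) | A (traj_extend z.1 z.2)].
rewrite (_ : (fun _ => _) = kfcomp (@next_law n) (EFin \o \1_B)).
  apply: measurable_kfcomp; first exact/measurable_EFinP.
  by move=> t; rewrite lee_fin.
rewrite (kfcompkindic _ mB); apply: funext => xi.
by congr (next_law _ _); rewrite xsectionE.
Qed.

Let traj_step0 : traj_step set0 = 0.
Proof. by apply: integral0_eq => xi _; rewrite preimage_set0 measure0. Qed.

Let traj_step_ge0 A : 0 <= traj_step A.
Proof. exact: integral_ge0. Qed.

Let traj_step_sigma_additive : semi_sigma_additive traj_step.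
Proof.
move=> F mF tF mUF.
rewrite [X in _ --> X](_ : _ =
  \int[P]_xi (\sum_(k <oo) next_law xi (traj_extend xi @^-1` F k))); last first.
  apply: eq_integral => xi _; rewrite preimage_bigcup.
  apply/esym/cvg_lim => //; apply: measure_semi_sigma_additive.
  - by move=> k; exact: measurable_section.
  - apply/trivIsetP => i j _ _ ij; move/trivIsetP : tF => /(_ i j I I ij) Fij.
    by rewrite -preimage_setI Fij preimage_set0.
  - by rewrite -preimage_bigcup; exact: measurable_section.
apply/cvg_closeP; split.
  by apply: is_cvg_nneseries => k _ _; exact: integral_ge0.
by rewrite closeE// integral_nneseries// => k; exact: measurable_integrand.
Qed.

HB.instance Definition _ := isMeasure.Build _ _ _ traj_step
  traj_step0 traj_step_ge0 traj_step_sigma_additive.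

Let traj_stepT : traj_step [set: _] = 1.
Proof.
transitivity (\int[P]_xi cst 1 xi).
  by apply: eq_integral => xi _; rewrite preimage_setT prob_kernel.
by rewrite integral_cst// mul1e; exact: probability_setT.
Qed.

HB.instance Definition _ :=
  Measure_isProbability.Build _ _ _ traj_step traj_stepT.

End extend.
End step.

(* The law of xi = (x_0, u_0, ..., u_{T-1}, x_T), that is
   p(x_0) \prod_(t < T) pi_t(u_t|x_t) iota_t(x_{t+1}|x_t, u_t). *)
Fixpoint traj_law (p0 : probability X R) T :
    ('I_T -> R.-pker X ~> U) -> ('I_T -> R.-pker (X * U) ~> X) ->
    probability (traj X U T) R :=
  match T with
  | 0 => fun _ _ => distribution p0 (@traj_init _ _ X U)
  | n.+1 => fun pi iota =>
      traj_step (pi ord_max) (iota ord_max)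
        (traj_law p0 (pi \o widen_ord (leqnSn n))
                     (iota \o widen_ord (leqnSn n)))
  end.

End trajectory_law.

Section conditional_law.
Context d d' (X : measurableType d) (U : measurableType d') (R : realType).
Variables (p : R.-pker X ~> U) (x : X).

(* The measure p x, which p : R.-pker X ~> U does not make canonically a
   probability (hence finite) measure. *)
Definition cond_law : set U -> \bar R := p x.

HB.instance Definition _ := Measure.on cond_law.

HB.instance Definition _ :=
  Measure_isProbability.Build _ _ _ cond_law (prob_kernel x).

End conditional_law.

Section log_ratio.
Local Open Scope charge_scope.
Context d d' (X : measurableType d) (U : measurableType d') (R : realType).
Variables (p q : R.-pker X ~> U).

(* r(x, u) = p(u|x) / q(u|x): a jointly measurable version of the densities
   dp(.|x)/dq(.|x). *)
Definition policy_ratio : set (X * U -> R) :=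
  [set r | measurable_fun [set: X * U] r /\
  forall x, ae_eq (cond_law q x) [set: U] (fun u => (r (x, u))%:E)
    ('d (charge_of_finite_measure (cond_law p x)) '/d (cond_law q x))].

(* Two versions agree q(.|x)-a.e. for each x, so the choice made here changes no
   expectation under a trajectory law using a policy p(.|x) << q(.|x); neither
   does ln y = 0 for y <= 0, since such values have p(.|x)-measure 0. *)
Definition log_ratio (z : X * U) : R := ln (xget (cst 1%R) policy_ratio z).

End log_ratio.

Section control_problem.
Context d d' (X : measurableType d) (U : measurableType d') (R : realType).
Variables (T : nat) (p0 : probability X R).
Variables (iota : 'I_T -> R.-pker (X * U) ~> X).
Variables (c : 'I_T -> X * U -> R) (cT : X -> R) (lam : R).

Implicit Types pi rho : 'I_T -> R.-pker X ~> U.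

Definition traj_cost (xi : traj X U T) : R :=
  (\sum_(t < T) c t (stage_at xi t) + cT (final_state xi))%R.

Definition traj_log_ratio pi rho (xi : traj X U T) : R :=
  (\sum_(t < T) log_ratio (pi t) (rho t) (stage_at xi t))%R.

Definition sp_cost pi rho (xi : traj X U T) : R :=
  (traj_cost xi + lam^-1 * traj_log_ratio pi rho xi)%R.

Definition J_SOC pi : \bar R := 'E_(traj_law p0 pi iota)[traj_cost].

(* J_SPSOC rho pi is J_{SP-SOC}(pi | rho). *)
Definition J_SPSOC rho pi : \bar R := 'E_(traj_law p0 pi iota)[sp_cost pi rho].

Definition finite_cost pi : Prop :=
  (traj_law p0 pi iota).-integrable setT (EFin \o traj_cost).

(* The policies over which J_{SP-SOC}(. | rho) is considered.  Absolute
   continuity gives the densities dpi_t(.|x) / drho_t(.|x) for each x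
   separately; for log (pi_t / rho_t) at (x_t, u_t) to be a random variable they
   must also have a version jointly measurable in (x, u), which is automatic
   when U has a countably generated sigma-algebra. *)
Definition admissible rho : set ('I_T -> R.-pker X ~> U) :=
  [set pi : 'I_T -> R.-pker X ~> U |
   [/\ forall t x, pi t x `<< rho t x,
    forall t, policy_ratio (pi t) (rho t) !=set0,
    finite_cost pi &
    (traj_law p0 pi iota).-integrable setT (EFin \o sp_cost pi rho)]].

End control_problem.

Definition majorizes_at (T : Type) (R : realType) (A : set T)
    (F G : T -> \bar R) (y : T) : Prop :=
  F y = G y /\ forall x, A x -> G x <= F x.

Definition argmin_on (T : Type) (R : realType) (A : set T)
    (F : T -> \bar R) : set T :=
  [set x | A x /\ forall y, A y -> F x <= F y].

(* Main.v *)
Require Import Defs.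
From mathcomp Require Import all_boot all_order all_algebra.
From mathcomp Require Import all_classical all_reals all_analysis.
From mathcomp Require Import measurable_realfun.
Import Order.TTheory GRing.Theory Num.Theory.

Local Open Scope classical_set_scope.
Local Open Scope ring_scope.

(** The difference of the two objectives is lam^-1 E[sum_t L_t], where L_t is
the log-ratio ln (dpi_t / drho_t) at (x_t, u_t) and rho is the baseline; the
chain rule identifies the expectation with the relative entropy of the two
trajectory laws, so the majorization is Gibbs' inequality.  It is proved here
stage by stage from the pointwise bound L >= 1 - exp (- L)
([J_SOC_le_J_SPSOC]).  Given x_t = x, the conditional mean of exp (- L_t) is

  int exp (- ln r) dpi_t(.|x) = int exp (- ln r) r drho_t(.|x) <= 1,

with r the density of pi_t(.|x) with respect to rho_t(.|x)
([integral_exp_log_ratio_le1]), and averaging over x_t gives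
E[1 - exp (- L_t)] >= 0.  The minorant sum_t (1 - exp (- L_t)) is integrable even
when the single L_t are not, so the comparison is made on the whole sum.

What links kernels to trajectories is the tower property
[integral_stage_at]: in the law of the trajectory, u_t has conditional law
pi_t(.|x_t) given x_t.

For equality at the baseline, the density of rho_t(.|x) with respect to itself
is 1 almost everywhere, whatever version is chosen, so that the log-ratios
vanish almost surely along the trajectory.  The same fact makes the baseline
admissible ([admissible_refl]), hence a competitor of any minimizer pi, and
descent is J_SOC pi <= J_SPSOC rho pi <= J_SPSOC rho rho = J_SOC rho. *)

(** * Integrals against the trajectory law *)

Section trajectory_integrals.
Local Open Scope ereal_scope.
Context {d d' : measure_display} {X : measurableType d} {U : measurableType d'}
  {R : realType}.

(** [traj_step p iota P] is the law of a composition of kernels: draw xi from P,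
then (u, x) from [next_law p iota xi], then apply the deterministic kernel of
[traj_extend].  The statement is the integral formula for such compositions,
whose kernels carry a dummy parameter in [unit]. *)
Lemma integral_traj_step (p : R.-pker X ~> U) (iota : R.-pker (X * U) ~> X)
    n (P : probability (traj X U n) R) (f : traj X U n.+1 -> \bar R) :
  (forall xi, 0 <= f xi) -> measurable_fun [set: traj X U n.+1] f ->
  \int[traj_step p iota P]_xi f xi =
  \int[P]_xi \int[next_law p iota xi]_ux f (traj_extend xi ux).
Proof.
move=> f0 mf.
have mP : measurable_fun [set: unit]
  (fun=> P : pprobability (traj X U n) R) by exact: measurable_cst.
have me : measurable_fun [set: (unit * traj X U n) * (U * X)]
    (fun z => traj_extend z.1.2 z.2).
  apply: (@measurableT_comp _ _ _ _ _ _ (fun z => traj_extend z.1 z.2) _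
    (fun z : (unit * traj X U n) * (U * X) => (z.1.2, z.2))).
    exact: measurable_traj_extend.
  apply/measurable_fun_pairP; split => /=; last exact: measurable_snd.
  exact: (measurableT_comp measurable_snd measurable_fst).
pose k : R.-sfker (unit * traj X U n) ~> traj X U n.+1 :=
  mkcomp (kernel.kernel_snd (next_law p iota (n := n))) (kdirac me).
transitivity (\int[kcomp (kprobability mP) k tt]_xi f xi).
  apply: eq_measure_integral => A mA _.
  apply: eq_integral => xi _ /=.
  have mxA : measurable (traj_extend xi @^-1` A).
    rewrite -[X in measurable X]setTI.
    exact: (measurable_fun_pair2 (tt, xi) me).
  rewrite /kcomp /kernel.kernel_snd /=.
  transitivity (\int[next_law p iota xi]_ux (\1_(traj_extend xi @^-1` A) ux)%:E).
    by rewrite integral_indic// setIT.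
  by apply: eq_integral => ux _; rewrite diracE indicE.
rewrite integral_kcomp//; apply: eq_integral => xi _.
rewrite integral_kcomp//; apply: eq_integral => ux _.
by rewrite integral_dirac// diracT mul1e.
Qed.

(** The first marginal of [next_law p iota xi] is the law of the action, since
the kernel iota has total mass 1. *)
Lemma integral_next_law (p : R.-pker X ~> U) (iota : R.-pker (X * U) ~> X)
    n (xi : traj X U n) (h : U -> \bar R) :
  (forall u, 0 <= h u) -> measurable_fun [set: U] h ->
  \int[next_law p iota xi]_ux h ux.1 = \int[p (final_state xi)]_u h u.
Proof.
move=> h0 mh.
transitivity (\int[pushforward (next_law p iota xi) fst]_u h u).
  by rewrite ge0_integral_pushforward//; exact: measurable_fst.
apply: eq_measure_integral => A mA _; rewrite /pushforward /= /kproduct.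
transitivity (\int[p (final_state xi)]_u (\1_A u)%:E).
  apply: eq_integral => u _; rewrite /kernel.intker_indic /=.
  transitivity (\int[iota (final_state xi, u)]_x (cst (\1_A u)%:E) x).
    by apply: eq_integral => x _; rewrite !indicE.
  by rewrite integral_cst// prob_kernel mule1.
by rewrite integral_indic// setIT.
Qed.

Lemma measurable_stage_at n (t : 'I_n) :
  measurable_fun [set: traj X U n] (fun xi => stage_at xi t).
Proof.
apply/measurable_fun_pairP; split => /=.
  exact: (measurableT_comp (measurable_tnth _) measurable_fst).
exact: (measurableT_comp (measurable_tnth _) measurable_snd).
Qed.

Lemma stage_at_extend_widen n (xi : traj X U n) (ux : U * X) (t : 'I_n) :
  stage_at (traj_extend xi ux) (widen_ord (leqnSn n) t) = stage_at xi t.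
Proof.
rewrite /stage_at; congr pair => /=.
  rewrite !(tnth_nth ux.2) /= nth_rcons size_tuple.
  by rewrite (leq_trans (ltn_ord t)).
by rewrite !(tnth_nth ux.1) /= nth_rcons size_tuple ltn_ord.
Qed.

Lemma stage_at_extend_max n (xi : traj X U n) (ux : U * X) :
  stage_at (traj_extend xi ux) ord_max = (final_state xi, ux.1).
Proof.
rewrite /stage_at /final_state; congr pair => /=.
  by rewrite !(tnth_nth ux.2) /= nth_rcons size_tuple ltnSn.
by rewrite !(tnth_nth ux.1) /= nth_rcons size_tuple ltnn eqxx.
Qed.

(** Tower property.  By induction on the horizon: the steps after stage t leave
[stage_at xi t] unchanged and have total mass 1, and at the last stage the action
is drawn from the policy at the current final state. *)
Lemma integral_stage_at (p0 : probability X R) n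
    (pi : 'I_n -> R.-pker X ~> U) (iota : 'I_n -> R.-pker (X * U) ~> X)
    (t : 'I_n) (g : X * U -> \bar R) :
  (forall z, 0 <= g z) -> measurable_fun [set: X * U] g ->
  \int[traj_law p0 pi iota]_xi g (stage_at xi t) =
  \int[traj_law p0 pi iota]_xi
    \int[pi t (stage_at xi t).1]_u g ((stage_at xi t).1, u).
Proof.
move=> g0 mg; have mgi (q : R.-pker X ~> U) :
    measurable_fun [set: X] (fun x => \int[q x]_u g (x, u)).
  exact: measurable_kfcomp.
elim: n pi iota t => [pi iota []//|n IH pi iota t].
have mgt := measurableT_comp mg (measurable_stage_at _ t).
have mgit : measurable_fun [set: traj X U n.+1] (fun xi =>
    \int[pi t (stage_at xi t).1]_u g ((stage_at xi t).1, u)).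
  exact: (measurableT_comp (mgi (pi t))
    (measurableT_comp measurable_fst (measurable_stage_at _ t))).
rewrite [traj_law _ _ _]/= !integral_traj_step//; last first.
  by move=> xi; exact: integral_ge0.
have [[s ->]|->] : (exists s, t = widen_ord (leqnSn n) s) \/ t = ord_max.
  have [tn|tn] := ltnP t n; first by left; exists (Ordinal tn); exact: val_inj.
  right; apply: val_inj; apply/eqP; rewrite eqn_leq tn andbT.
  exact: leq_ord.
- transitivity (\int[traj_law p0 (pi \o widen_ord (leqnSn n))
      (iota \o widen_ord (leqnSn n))]_xi g (stage_at xi s)).
    apply: eq_integral => xi _.
    under eq_integral do rewrite stage_at_extend_widen.
    by rewrite integral_cst// prob_kernel mule1.
  rewrite IH; apply: eq_integral => xi _.
  under [RHS]eq_integral do rewrite stage_at_extend_widen.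
  by rewrite integral_cst// prob_kernel mule1.
apply: eq_integral => xi _.
under eq_integral do rewrite stage_at_extend_max.
under [RHS]eq_integral do rewrite stage_at_extend_max.
rewrite (integral_next_law _ _ _ _ (fun u => g (final_state xi, u)))//.
  rewrite /= integral_cst// [X in _ = _ * X](_ : _ = 1) ?mule1//.
  exact: (prob_kernel (s := next_law (pi ord_max) (iota ord_max) (n := n))).

exact: (measurable_fun_pair2 (final_state xi) mg).
Qed.

End trajectory_integrals.

(** * The log-ratio of two policies *)

Section log_ratio_theory.
Local Open Scope ereal_scope.
Context {d d' : measure_display} {X : measurableType d} {U : measurableType d'}
  {R : realType}.
Implicit Types p q : R.-pker X ~> U.

Lemma policy_ratio_refl q : policy_ratio q q (cst 1%R).
Proof.
split=> // x.
apply: ae_eq_sym; apply: integral_ae_eq => //.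
- exact: Radon_Nikodym_integrable.
- exact: (measurable_cst 1).
- move=> A _ mA; rewrite -Radon_Nikodym_integral//.
  by rewrite (integral_cst _ mA 1) mul1e.
Qed.

Lemma measurable_log_ratio p q : policy_ratio p q !=set0 ->
  measurable_fun [set: X * U] (log_ratio p q).
Proof.
move=> /(xgetPex (cst 1%R))[mr _].
exact: (measurableT_comp (@measurable_ln R) mr).
Qed.

(** After the change of variables dp = f dq, with f = r q-almost everywhere, the
integrand is r / r = 1 where r > 0 and 0 where r = 0; the value of the integral
is thus q {r > 0} <= 1. *)
Lemma integral_exp_log_ratio_le1 p q x : policy_ratio p q !=set0 ->
  p x `<< q x -> \int[p x]_u (expR (- log_ratio p q (x, u)))%:E <= 1.
Proof.
move=> pq0 pq; have mL := measurable_log_ratio _ _ pq0.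
have [mr rE] := xgetPex (cst 1%R) pq0.
set r := xget _ _ in mr rE.
set e := fun u => (expR (- log_ratio p q (x, u)))%:E.
have me : measurable_fun [set: U] e.
  apply/measurable_EFinP; apply: measurableT_comp => //.
  apply: measurableT_comp => //.
  exact: (measurable_fun_pair2 x mL).
pose f := Radon_Nikodym_SigmaFinite.f (cond_law p x) (cond_law q x).
have f0 u : 0 <= f u by exact: Radon_Nikodym_SigmaFinite.f_ge0.
have mf : measurable_fun [set: U] f.
  have := Radon_Nikodym_SigmaFinite.f_integrable (nu := cond_law p x)
    (mu := cond_law q x) pq.
  exact: measurable_int.
have e0 u : 0 <= e u by rewrite lee_fin expR_ge0.
rewrite -[leLHS](Radon_Nikodym_SigmaFinite.change_of_variables
  (nu := cond_law p x) (mu := cond_law q x) pq)//.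
rewrite -[leRHS](prob_kernel (s := q) x) -[leRHS]mul1e -integral_cst//.
apply: ae_ge0_le_integral => //.
- by move=> u _; rewrite mule_ge0.
- exact: emeasurable_funM.
move: (rE x) (ae_eq_Radon_Nikodym_SigmaFinite
  (nu := cond_law p x) (mu := cond_law q x) pq measurableT).
rewrite /ae_eq; apply: filterS2 => u /= rf ff _.
have := f0 u; rewrite -/f /e /log_ratio -/r in ff *.
rewrite ff// -rf// lee_fin -EFinM lee_fin => r0.
(* where r = 0 the convention ln 0 = 0 is harmless: the factor r vanishes *)
have [rp|rn] := ltP 0%R (r (x, u)); first by rewrite expRN lnK// mulVf// gt_eqF.
by rewrite (le_anti (introT andP (conj rn r0))) mulr0.
Qed.

(** The version of the density chosen by [log_ratio] agrees q(.|x)-almost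
everywhere with the constant version 1. *)
Lemma log_ratio_refl_ae q x :
  {ae q x, forall u, log_ratio q q (x, u) = 0%R}.
Proof.
have [_ /(_ x) rE] := xgetPex (cst 1%R) (ex_intro _ _ (policy_ratio_refl q)).
have [_ /(_ x) oneE] := policy_ratio_refl q.
move: rE oneE; rewrite /ae_eq.
apply: filterS2 => u /= /(_ Logic.I) rE /(_ Logic.I) oneE.
by rewrite /log_ratio; move: rE; rewrite -oneE => -[->]; rewrite ln1.
Qed.

End log_ratio_theory.

(** * Majorization *)

Section majorization.
Local Open Scope ereal_scope.
Context {d d' : measure_display} {X : measurableType d} {U : measurableType d'}
  {R : realType}.
Context (T : nat) (p0 : probability X R).
Context (iota : 'I_T -> R.-pker X * U ~> X).
Context (c : 'I_T -> X * U -> R) (cT : X -> R) (lam : R).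
Implicit Types pi rho : 'I_T -> R.-pker X ~> U.

Lemma measurable_traj_log_ratio pi rho :
  (forall t, policy_ratio (pi t) (rho t) !=set0) ->
  measurable_fun [set: traj X U T] (traj_log_ratio pi rho).
Proof.
move=> r0; apply: measurable_sum => t.
exact: (measurableT_comp (measurable_log_ratio _ _ (r0 t))
  (measurable_stage_at _ t)).
Qed.

(** The tower property applied to |L_t| transfers the almost everywhere vanishing
under every kernel pi_t(.|x) to the trajectory law. *)
Lemma traj_log_ratio_refl_ae pi :
  {ae traj_law p0 pi iota, forall xi, traj_log_ratio pi pi xi = 0%R}.
Proof.
have r0 t : policy_ratio (pi t) (pi t) !=set0.
  by exists (cst 1%R); exact: policy_ratio_refl.
have L0 t : {ae traj_law p0 pi iota, forall xi,
    log_ratio (pi t) (pi t) (stage_at xi t) = 0%R}.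
  have mL := measurable_log_ratio _ _ (r0 t).
  have mLt := measurableT_comp mL (measurable_stage_at _ t).
  have : ae_eq (traj_law p0 pi iota) setT
      (EFin \o (log_ratio (pi t) (pi t) \o @stage_at _ _ X U T ^~ t)) (cst 0).
    apply/(ae_eq_integral_abs _ measurableT); first exact/measurable_EFinP.
    rewrite (integral_stage_at _ _ _ _ t
      (fun z => `|(log_ratio (pi t) (pi t) z)%:E|))//; last first.
      by apply: measurableT_comp => //; exact/measurable_EFinP.
    apply: integral0_eq => xi _.
    set x := (stage_at xi t).1.
    apply/(ae_eq_integral_abs _ measurableT).
      by apply/measurable_EFinP; exact: (measurable_fun_pair2 x mL).
    by have := log_ratio_refl_ae (pi t) x; apply: filterS => u /= ->.
  by rewrite /ae_eq; apply: filterS => xi /= /(_ Logic.I) [].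
have : {ae traj_law p0 pi iota, forall xi, forall t,
    log_ratio (pi t) (pi t) (stage_at xi t) = 0%R}.
  exact: filter_forall.
by apply: filterS => xi L0xi; rewrite /traj_log_ratio big1.
Qed.

Lemma integral_exp_stage_log_ratio_le1 pi rho t :
  (forall x, pi t x `<< rho t x) -> policy_ratio (pi t) (rho t) !=set0 ->
  \int[traj_law p0 pi iota]_xi
    (expR (- log_ratio (pi t) (rho t) (stage_at xi t)))%:E <= 1.
Proof.
move=> ac r0; have mL := measurable_log_ratio _ _ r0.
have me : measurable_fun [set: X * U]
    (fun z => (expR (- log_ratio (pi t) (rho t) z))%:E).
  by apply/measurable_EFinP; do 2 apply: measurableT_comp => //.
rewrite (integral_stage_at _ _ _ _ t
  (fun z => (expR (- log_ratio (pi t) (rho t) z))%:E))//.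
rewrite -[leRHS](@probability_setT _ _ _ (traj_law p0 pi iota)).
rewrite -[leRHS]mul1e -integral_cst//.
apply: ge0_le_integral => //.
- by move=> xi _; apply: integral_ge0 => u _; rewrite lee_fin expR_ge0.
- have mie : measurable_fun [set: X] (fun x => \int[pi t x]_u
      (expR (- log_ratio (pi t) (rho t) (x, u)))%:E).
    exact: (measurable_kfcomp (pi t) me).
  exact: (measurableT_comp mie
    (measurableT_comp measurable_fst (measurable_stage_at _ t))).
- by move=> xi _; exact: integral_exp_log_ratio_le1.
Qed.

(** Gibbs' inequality, through the integrable minorant
sum_t (1 - exp (- L_t)) of the trajectory log-ratio, whose mean is
nonnegative. *)
Lemma J_SOC_le_J_SPSOC rho pi : (0 < lam)%R ->
  admissible p0 iota c cT lam rho pi ->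
  J_SOC p0 iota c cT pi <= J_SPSOC p0 iota c cT lam rho pi.
Proof.
move=> lam0 [ac r0 fc fsp]; rewrite /J_SOC /J_SPSOC unlock.
set P := traj_law p0 pi iota in fc fsp *.
pose e t (xi : traj X U T) := expR (- log_ratio (pi t) (rho t) (stage_at xi t)).
have ie t : P.-integrable setT (EFin \o e t).
  apply/integrableP; split.
    apply/measurable_EFinP; do 2 apply: measurableT_comp => //.
    exact: (measurableT_comp (measurable_log_ratio _ _ (r0 t))
      (measurable_stage_at _ t)).
  apply: (@le_lt_trans _ _ 1); last exact: ltry.
  under eq_integral do rewrite gee0_abs ?lee_fin ?expR_ge0//.
  exact: integral_exp_stage_log_ratio_le1.
have i1 : P.-integrable setT (cst 1 : traj X U T -> \bar R).
  exact: finite_measure_integrable_cst.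
have iw t : P.-integrable setT (fun xi => (1 - e t xi)%:E).
  exact: (integrableB measurableT i1 (ie t)).
have iW : P.-integrable setT (fun xi => \sum_(t < T) (1 - e t xi)%:E).
  exact: integrable_sum.
have W0 : 0 <= \int[P]_xi \sum_(t < T) (1 - e t xi)%:E.
  rewrite integral_sum//; apply: sume_ge0 => t _.
  have int1 : \int[P]_xi (cst 1%R xi)%:E = 1.
    by rewrite (integral_cst P measurableT 1) mul1e; exact: probability_setT.
  rewrite (integralB_EFin measurableT (f1 := cst 1%R) i1 (ie t)) int1.
  rewrite sube_ge0.
    exact: integral_exp_stage_log_ratio_le1.
  by rewrite orbT.
have iZ : P.-integrable setT
    (fun xi => lam^-1%:E * \sum_(t < T) (1 - e t xi)%:E).
  exact: integrableZl.
have le1 : \int[P]_xi (traj_cost c cT xi)%:E <= \int[P]_xi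
    ((traj_cost c cT xi)%:E + lam^-1%:E * \sum_(t < T) (1 - e t xi)%:E).
  rewrite integralD// integralZl// leeDl// mule_ge0// lee_fin invr_ge0.
  exact: ltW.
apply: (le_trans le1).
apply: le_integral => //; first exact: integrableD.
move=> xi _; rewrite sumEFin -EFinM -EFinD lee_fin /sp_cost.
rewrite lerD2l ler_pM2l ?invr_gt0//; apply: ler_sum => t _.
by rewrite lerBlDr -lerBlDl; exact: expR_ge1Dx.
Qed.

Lemma sp_cost_refl_ae pi : {ae traj_law p0 pi iota, forall xi,
  sp_cost c cT lam pi pi xi = traj_cost c cT xi}.
Proof.
apply: filterS (traj_log_ratio_refl_ae pi) => xi L0.
by rewrite /sp_cost L0 mulr0 addr0.
Qed.

Lemma admissible_refl pi : finite_cost p0 iota c cT pi ->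
  admissible p0 iota c cT lam pi pi.
Proof.
move=> fc; have r0 t : policy_ratio (pi t) (pi t) !=set0.
  by exists (cst 1%R); exact: policy_ratio_refl.
have mc := measurable_int _ fc.
split => //; first by move=> t x A.
have msp : measurable_fun [set: traj X U T]
    (EFin \o sp_cost c cT lam pi pi).
  apply/measurable_EFinP; apply: measurable_funD; first exact/measurable_EFinP.
  by apply: measurable_funM => //; exact: measurable_traj_log_ratio.
apply/integrableP; split => //.
rewrite (ae_eq_integral (abse \o (EFin \o traj_cost c cT)))//.
- by have /integrableP[] := fc.
- exact: measurableT_comp.
- exact: measurableT_comp.
by apply: filterS (sp_cost_refl_ae pi) => xi /= ->.
Qed.

Lemma J_SPSOC_refl pi : finite_cost p0 iota c cT pi ->
  J_SPSOC p0 iota c cT lam pi pi = J_SOC p0 iota c cT pi.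
Proof.
move=> fc; have [_ _ _ fsp] := admissible_refl _ fc.
rewrite /J_SPSOC /J_SOC unlock; apply: ae_eq_integral => //.
- exact: measurable_int fsp.
- exact: measurable_int fc.
by apply: filterS (sp_cost_refl_ae pi) => xi /= ->.
Qed.

End majorization.

Theorem mainTheorem3 (d d' : measure_display) (X : measurableType d)
    (U : measurableType d') (R : realType) (T : nat) (p0 : probability X R)
    (iota : 'I_T -> R.-pker (X * U) ~> X)
    (c : 'I_T -> X * U -> R) (cT : X -> R) (lam : R)
    (hc : forall t, measurable_fun [set: X * U] (c t))
    (hcT : measurable_fun [set: X] cT)
    (hc0 : forall t z, 0 <= c t z)
    (hcT0 : forall x, 0 <= cT x)
    (hlam : 0 < lam)
    (pik : 'I_T -> R.-pker X ~> U)
    (hpik : finite_cost p0 iota c cT pik) :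
  majorizes_at (admissible p0 iota c cT lam pik)
    (J_SPSOC p0 iota c cT lam pik) (J_SOC p0 iota c cT) pik /\
  (forall pik1 : 'I_T -> R.-pker X ~> U,
    argmin_on (admissible p0 iota c cT lam pik)
      (J_SPSOC p0 iota c cT lam pik) pik1 ->
    (J_SOC p0 iota c cT pik1 <= J_SOC p0 iota c cT pik)%E).
Proof.
have JE := J_SPSOC_refl _ p0 iota c cT lam pik hpik.
have Jle pi : admissible p0 iota c cT lam pik pi ->
    (J_SOC p0 iota c cT pi <= J_SPSOC p0 iota c cT lam pik pi)%E.
  exact: J_SOC_le_J_SPSOC.
split=> [|pik1 [adm1 min1]]; first by split.
rewrite (le_trans (Jle _ adm1))// -JE.
exact/min1/admissible_refl.
Qed.
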